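(* Let $s,N\in\mathbb{N}$ with $2\leq N\leq s$. For $k\in\mathbb{N}_0$ let \[ \alpha_q(k)=(-1)^k q^{s\binom{k+1}{2}-k}\,[2sk+1]\,\frac{(xq;q^s)_k\,(q/x;q^s)_k\,(q;q^s)_k}{(xq^s;q^s)_k\,(q^s/x;q^s)_k\,(q^s;q^s)_k}, \] and \[ t_q(k)=\sum_{\substack{i_1,\ldots,i_N\geq 0\\ i_1+\cdots+i_N=k}}\alpha_q(i_1)\cdots\alpha_q(i_N). \] Then for every positive integer $n$ all of whose prime factors are congruent to $1$ modulo $s$, \[ \sum_{k=0}^{n-1}t_q(k)\equiv q^{N(n-1)(n-s+1)/(2s)}[n]^N(-1)^{N(n-1)/s}\pmod{[n](1-xq^n)(x-q^n)}. \]
   Context: $x$ is an indeterminate and $q$ a variable. $(a;q)_0=1$, $(a;q)_k=\prod_{j=0}^{k-1}(1-aq^j)$; $[n]=[n]_q=(1-q^n)/(1-q)=1+q+\cdots+q^{n-1}$. For rational functions $A,B$ and a polynomial $P$, $A\equiv B\pmod P$ means that, writing $A-B=A_1/A_2$ in lowest terms, $P$ divides $A_1$ and $\gcd(P,A_2)=1$. *)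

(* Defs.v *)
From HB Require Import structures.
From mathcomp Require Import all_boot all_order all_algebra.
Set Implicit Arguments.
Unset Strict Implicit.
Unset Printing Implicit Defensive.
Import GRing.Theory.
Local Open Scope ring_scope.

(* Divisibility and coprimality in the ring itself. The library's [%|] on
   polynomials is pseudo-divisibility: it ignores factors from the coefficient
   ring, so it is not divisibility in {poly {poly rat}}. *)
Definition rdvd (R : idomainType) (a b : R) : Prop := exists c : R, b = c * a.

Definition rcoprime (R : idomainType) (a b : R) : Prop :=
  forall d : R, rdvd d a -> rdvd d b -> d \is a GRing.unit.

(* A congruent to B modulo P in the fraction field of R. *)
Definition congr_frac (R : idomainType) (A B : {fraction R}) (P : R) : Prop :=
  exists A1 A2 : R,
    [/\ A2 != 0,
        A - B = FracField.tofrac A1 / FracField.tofrac A2,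
        rcoprime A1 A2,
        rdvd P A1
      & rcoprime P A2].

(* The polynomial form of (1 - q^n) / (1 - q), so that it also makes sense in
   the polynomial ring, where the modulus lives. *)
Definition qint (R : nzRingType) (q : R) (n : nat) : R := \sum_(i < n) q ^+ i.

(* (a; b)_k, with base b. *)
Definition qpoch (F : fieldType) (a b : F) (k : nat) : F :=
  \prod_(j < k) (1 - a * b ^+ j).

Definition alpha (F : fieldType) (x q : F) (s k : nat) : F :=
  (-1) ^+ k * q ^ ((s * 'C(k.+1, 2))%N%:Z - k%:Z) * qint q (2 * s * k + 1)
  * (qpoch (x * q) (q ^+ s) k * qpoch (q / x) (q ^+ s) k * qpoch q (q ^+ s) k)
  / (qpoch (x * q ^+ s) (q ^+ s) k * qpoch (q ^+ s / x) (q ^+ s) k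
     * qpoch (q ^+ s) (q ^+ s) k).

(* Each part of a composition of k into nonnegative parts is at most k, so the
   parts range over 'I_k.+1. *)
Definition tsum (F : fieldType) (x q : F) (s N k : nat) : F :=
  \sum_(i : {ffun 'I_N -> 'I_k.+1} | (\sum_(j < N) i j == k)%N)
    \prod_(j < N) alpha x q s (i j).

(* The polynomial ring Q[q, x], with q the inner and x the outer variable,
   and its field of fractions Q(q, x). *)
Definition Qqx : idomainType := {poly {poly rat}}.
Definition px : Qqx := 'X.
Definition pq : Qqx := 'X%:P.
Definition fx : {fraction Qqx} := FracField.tofrac px.
Definition fq : {fraction Qqx} := FracField.tofrac pq.

(* Main.v *)
(* A polynomial in q and x is divisible by [n](1 - xq^n)(x - q^n) as soon as it
   vanishes at q = zeta for every n-th root of unity zeta != 1, and at x = q^n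
   and x = q^-n; so it suffices to specialize both sides at these points.

   At x = q^n or x = q^-n, with n = sm + 1, alpha_q(k) vanishes for m < k < n.
   Since Nm <= sm < n, no composition is lost by the truncation k < n, and the
   sum of the t_q(k) is the N-th power of the sum of the alpha_q(k), a
   terminating very-well-poised 6phi5 (with one parameter sent to infinity),
   which is summed by a WZ pair.

   At a primitive d-th root of unity, d = sm + 1 dividing n, the alpha_q(k) have
   finite values with alpha(ld + i) = c_l alpha(i) for i < d, and alpha(i) = 0
   for m < i < d. So the generating polynomial of the alpha(k) is C(X^d) a(X)
   with deg a <= m, its N-th power is C(X^d)^N a(X)^N with deg a^N < d, and
   the truncated sum contains the factor a(1)^N. The antisymmetry
   alpha(m - i) = - alpha(i) gives a(1) = 0. *)
Require Import Defs.
From mathcomp Require Import all_boot all_order all_algebra all_field.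
From mathcomp Require Import ring zify.
From Stdlib Require Import Classical.
Set Implicit Arguments.
Unset Strict Implicit.
Unset Printing Implicit Defensive.
Import GRing.Theory.
Local Open Scope ring_scope.

(** * A terminating well-poised sum *)

Section TerminatingSum.
Variables (F : fieldType) (a c Q : F).

(** Term ratio, apart from the very-well-poised factor, of a terminating 6phi5 in base [Q] with
    parameters a, c, Q^-M and one further parameter sent to infinity. *)
Definition wp_step (M j : nat) : F :=
  - ((1 - a * Q ^+ j) * (1 - Q ^+ j / Q ^+ M) * (1 - c * Q ^+ j)
     * (a * Q ^+ (M.+1 + j) / c))
  / ((1 - Q ^+ j.+1) * (1 - a * Q ^+ (M.+1 + j)) * (1 - a * Q ^+ j.+1 / c)).

Definition wp_term (M k : nat) : F :=
  (1 - a * Q ^+ (2 * k)) * \prod_(j < k) wp_step M j.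

(* [wp_step M] and [wp_step M.+1] differ from [wp_aux (Q ^+ M.+1)] in one factor
   each, so that both products of steps are rational multiples of a single
   product of [wp_aux]. *)
Definition wp_aux (w : F) (j : nat) : F :=
  - ((1 - a * Q ^+ j) * (1 - Q ^+ j / w) * (1 - c * Q ^+ j)
     * (a * w * Q ^+ j / c))
  / ((1 - Q ^+ j.+1) * (1 - a * w * Q ^+ j) * (1 - a * Q ^+ j.+1 / c)).

Hypotheses (Q0 : Q != 0) (c0 : c != 0).
Hypothesis Q1 : forall j, (0 < j)%N -> 1 - Q ^+ j != 0.
Hypothesis aQ1 : forall j, (0 < j)%N -> 1 - a * Q ^+ j != 0.
Hypothesis ac1 : forall j, (0 < j)%N -> c - a * Q ^+ j != 0.

(** The factor 1 - Q^j / Q^M is 1 - Q^(j+1) / w, the corresponding factor of [wp_aux] at the next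
    index, so the ratio of the two products telescopes. *)
Lemma wp_prod_low (M k : nat) (w := Q ^+ M.+1) :
  (\prod_(j < k) wp_step M j) * (1 - w^-1)
  = (\prod_(j < k) wp_aux w j) * (1 - Q ^+ k / w).
Proof.
have w0 : w != 0 by rewrite expf_neq0.
elim: k => [|k IH]; first by rewrite !big_ord0 expr0 !mul1r.
rewrite !big_ord_recr /= mulrAC {}IH -!mulrA; congr (_ * _).
rewrite /wp_step /wp_aux.
have -> : Q ^+ k / Q ^+ M = Q ^+ k.+1 / w.
  by rewrite /w !exprS; field; rewrite Q0 expf_neq0.
have -> : a * Q ^+ (M.+1 + k) = a * w * Q ^+ k by rewrite exprD mulrA.
by rewrite !mulrA; ring.
Qed.

Lemma wp_prod_high (M k : nat) (w := Q ^+ M.+1) :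
  (\prod_(j < k) wp_step M.+1 j) * (1 - a * w * Q ^+ k)
  = (\prod_(j < k) wp_aux w j) * Q ^+ k * (1 - a * w).
Proof.
have w0 : w != 0 by rewrite expf_neq0.
have awQ i : 1 - a * w * Q ^+ i != 0.
  by rewrite -mulrA -exprD aQ1 // addSn.
elim: k => [|k IH]; first by rewrite !big_ord0 expr0 !mulr1.
rewrite !big_ord_recr /=.
have -> : \prod_(j < k) wp_step M.+1 j
   = (\prod_(j < k) wp_aux w j) * Q ^+ k * (1 - a * w) / (1 - a * w * Q ^+ k).
  by rewrite -IH mulfK.
rewrite /wp_step /wp_aux -/w.
have -> : a * Q ^+ (M.+2 + k) = a * w * Q ^+ k.+1.
  by rewrite addSnnS exprD mulrA.
have := Q1 (ltn0Sn k); have := ac1 (ltn0Sn k).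
move: (awQ k) (awQ k.+1); rewrite exprS.
move: (Q ^+ k) (\prod_(j < k) _) => K P h1 h2 h3 h4.
by field; rewrite c0 h3 h1 h4 w0 h2.
Qed.

Lemma wp_sum_rec (M : nat) :
  (\sum_(0 <= k < M.+2) wp_term M.+1 k) * (1 - a * Q ^+ M.+1 / c)
  = (\sum_(0 <= k < M.+1) wp_term M k) * (1 - a * Q ^+ M.+1).
Proof.
set w := Q ^+ M.+1.
have w0 : w != 0 by rewrite expf_neq0.
have wB1 : w - 1 != 0 by rewrite -opprB oppr_eq0 Q1.
have w1 : 1 - w^-1 != 0.
  by rewrite -(mulfV w0) -[X in _ - X]mul1r -mulrBl mulf_neq0 ?invr_eq0.
have awQ i : 1 - a * w * Q ^+ i != 0 by rewrite -mulrA -exprD aQ1 // addSn.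
(* The extra term is zero: its last step contains 1 - Q^M / Q^M. *)
have -> : \sum_(0 <= k < M.+1) wp_term M k = \sum_(0 <= k < M.+2) wp_term M k.
  rewrite [RHS]big_nat_recr //= [X in _ + X]/wp_term big_ord_recr /=.
  rewrite [X in _ * (_ * X)]/wp_step divff ?expf_neq0 // subrr.
  by rewrite !(mulr0, mul0r, oppr0) addr0.
(* The WZ mate: the difference of the two summands is [G k.+1 - G k]. *)
pose G k := (1 - Q ^+ k) * (1 - a * Q ^+ k / c) * \prod_(j < k) wp_aux w j
             * (1 - a * w) / (1 - w^-1).
apply/eqP; rewrite -subr_eq0 !mulr_suml -sumrB; apply/eqP.
(* [G] vanishes at 0 through 1 - Q^0 and at M + 2 through the factor 1 - Q^(M+1) / w of
   [wp_aux w M.+1]. *)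
rewrite (@telescope_sumr_eq _ _ _ G) // => [|k _].
  have aux0 : wp_aux w M.+1 = 0.
    by rewrite /wp_aux -/w divff // subrr !(mulr0, mul0r, oppr0).
  by rewrite /G big_ord_recr /= aux0 expr0 subrr !(mulr0, mul0r) subr0.
have low := wp_prod_low M k; have high := wp_prod_high M k.
rewrite -/w in low high.
rewrite /wp_term.
have -> : \prod_(j < k) wp_step M.+1 j
   = (\prod_(j < k) wp_aux w j) * Q ^+ k * (1 - a * w) / (1 - a * w * Q ^+ k).
  by rewrite -high mulfK.
have -> : \prod_(j < k) wp_step M j
   = (\prod_(j < k) wp_aux w j) * (1 - Q ^+ k / w) / (1 - w^-1).
  by rewrite -low mulfK.
rewrite /G big_ord_recr /= [wp_aux w k]/wp_aux.
rewrite mulnC exprM.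
move: (Q1 (ltn0Sn k)) (ac1 (ltn0Sn k)) (awQ k); rewrite exprS.
move: (Q ^+ k) (\prod_(j < k) _) => K P h1 h2 h3.
by field; rewrite w0 wB1 c0 h2 h3 h1.
Qed.

Lemma wp_sum (M : nat) :
  (\sum_(0 <= k < M.+1) wp_term M k) * \prod_(j < M) (1 - a * Q ^+ j.+1 / c)
  = \prod_(j < M.+1) (1 - a * Q ^+ j).
Proof.
elim: M => [|M IH].
  by rewrite big_nat1 /wp_term !big_ord0 big_ord1 !mulr1.
rewrite big_ord_recr /= mulrCA wp_sum_rec mulrA [_ * \sum_(_ <= _ < _) _]mulrC.
by rewrite IH [RHS]big_ord_recr.
Qed.

End TerminatingSum.

(** * The summand as a product of steps, and its sum at x = q^n *)

Lemma qint_mul_one_sub (F : fieldType) (q : F) (n : nat) :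
  (1 - q) * qint q n = 1 - q ^+ n.
Proof. by rewrite -opprB mulNr -subrX1 opprB. Qed.

(** Ratio of consecutive summands without the factor [2sk+1]. The exponent s binom(k+1,2) - k grows
    by s(j+1) - 1, which is nonnegative for s > 0, so natural powers suffice. *)
Definition alpha_step (F : fieldType) (x q : F) (s j : nat) : F :=
  - q ^+ (s * j.+1).-1
  * ((1 - x * q ^+ (s * j).+1) * (1 - q ^+ (s * j).+1 / x)
     * (1 - q ^+ (s * j).+1))
  / ((1 - x * q ^+ (s * j.+1)) * (1 - q ^+ (s * j.+1) / x)
     * (1 - q ^+ (s * j.+1))).

Lemma alphaE (F : fieldType) (x q : F) (s k : nat) : (0 < s)%N -> q != 0 ->
  alpha x q s k = qint q (2 * s * k).+1 * \prod_(j < k) alpha_step x q s j.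
Proof.
move=> s0 q0; rewrite /alpha addn1 [_ * qint _ _]mulrC -!mulrA; congr (_ * _).
rewrite /alpha_step /qpoch big_split /= prodfV big_split /= !mulrA.
rewrite -2!(mulrA ((-1) ^+ k * _)); congr (_ * _ / _); last first.
- rewrite -!big_split /=; apply: eq_bigr => j _.
  have E : q ^+ s * (q ^+ s) ^+ j = q ^+ (s * j.+1).
    by rewrite -exprM -exprD mulnS.
  by rewrite -[x * _ * _]mulrA [_ / x * _]mulrAC !E.
- rewrite -!big_split /=; apply: eq_bigr => j _.
  have E : q * (q ^+ s) ^+ j = q ^+ (s * j).+1 by rewrite -exprM exprS.
  by rewrite -[x * _ * _]mulrA [_ / x * _]mulrAC !E.
elim: k => [|k IH]; first by rewrite big_ord0 expr0 mul1r muln0 subr0 expr0z.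
rewrite big_ord_recr /= -IH binS bin1 mulnDr exprS mulN1r !mulNr mulrN -mulrA.
congr (- (_ * _)); rewrite exprnP -expfzDr //; congr (_ ^ _).
lia.
Qed.

(** Reduces x = q^-n to x = q^n: inverting x swaps two Pochhammer symbols in the numerator and two
    in the denominator. *)
Lemma alphaV (F : fieldType) (x q : F) (s k : nat) :
  alpha x^-1 q s k = alpha x q s k.
Proof.
rewrite /alpha !invrK (mulrC x^-1 q) (mulrC x^-1) (mulrC q x).
rewrite (mulrC (q ^+ s) x).
by rewrite [qpoch (q / x) _ _ * _]mulrC [qpoch (q ^+ s / x) _ _ * _]mulrC.
Qed.

Lemma exp_generic_inj (F : fieldType) (q : F) : q != 0 ->
  (forall j, (0 < j)%N -> 1 - q ^+ j != 0) -> injective (GRing.exp q).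
Proof.
move=> q0 q1; suff lt a b : (a < b)%N -> q ^+ a != q ^+ b.
  move=> a b /eqP E; apply/eqP; apply: contraTT E => ab.
  by case: (ltngtP a b) ab => // [/lt|/lt]; rewrite // eq_sym.
move=> ab; rewrite -subr_eq0 -(subnKC (ltnW ab)) exprD.
by rewrite -[X in X - _]mulr1 -mulrBr mulf_neq0 ?expf_neq0 // q1 // subn_gt0.
Qed.

Lemma mul_neq_succ_mul (s j m : nat) : (1 < s)%N -> (s * j != (s * m).+1)%N.
Proof.
move=> s1; apply/eqP => /(congr1 (modn^~ s)).
by rewrite -addn1 mulnC modnMl mulnC modnMDl modn_small.
Qed.

(** Instance of [wp_sum] with base q^s, a = q, c = q^(n+1): then Q^-m = q^(1-n), and the factor 1 -
    a Q^(2k) is (1 - q)[2sk+1]. *)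
Lemma alpha_sum_expn (F : fieldType) (q : F) (s m : nat) (n := (s * m).+1) :
  (1 < s)%N -> q != 0 -> (forall j, (0 < j)%N -> 1 - q ^+ j != 0) ->
  \sum_(0 <= k < m.+1) alpha (q ^+ n) q s k
  = q ^+ (s * 'C(m, 2) + m) * qint q n * (-1) ^+ m.
Proof.
move=> s1 q0 q1.
have s0 : (0 < s)%N by apply: ltnW.
have qn e : q ^+ e != 0 by rewrite expf_neq0.
have q11 : 1 - q != 0 by rewrite -[q]expr1 q1.
have cqn j : q ^+ n.+1 - q * (q ^+ s) ^+ j != 0.
  have -> : q ^+ n.+1 - q * (q ^+ s) ^+ j = q * (q ^+ n - q ^+ (s * j)).
    by rewrite exprS -exprM mulrBr.
  rewrite mulf_neq0 // subr_eq0 (inj_eq (exp_generic_inj q0 q1)).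
  by rewrite eq_sym mul_neq_succ_mul.
have qs1 j : (0 < j)%N -> 1 - (q ^+ s) ^+ j != 0.
  by move=> j0; rewrite -exprM q1 // muln_gt0 s0.
have qqs1 j : (0 < j)%N -> 1 - q * (q ^+ s) ^+ j != 0.
  by move=> j0; rewrite -exprM -exprS q1.
have stepE j : wp_step q (q ^+ n.+1) (q ^+ s) m j = alpha_step (q ^+ n) q s j.
  rewrite /wp_step /alpha_step.
  have -> : q ^+ (s * j.+1).-1 = q * (q ^+ s) ^+ (m.+1 + j) / q ^+ n.+1.
    apply: (canRL (mulfK (qn n.+1))).
    rewrite -exprM -exprS -exprD; congr (_ ^+ _).
    by move: s0; rewrite /n; nia.
  have -> : (1 - (q ^+ s) ^+ j / (q ^+ s) ^+ m) = 1 - q ^+ (s * j).+1 / q ^+ n.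
    by rewrite !exprS !exprM; congr (1 - _); field; rewrite q0 !expf_neq0.
  have -> : q ^+ n * q ^+ (s * j.+1) = q * (q ^+ s) ^+ (m.+1 + j).
    rewrite -exprM -exprD -exprS; congr (_ ^+ _); rewrite /n; lia.
  have -> : q * (q ^+ s) ^+ j.+1 / q ^+ n.+1 = q ^+ (s * j.+1) / q ^+ n.
    by rewrite -exprM [q ^+ n.+1]exprS invfM mulrACA divff // mul1r.
  have -> : q ^+ n.+1 * (q ^+ s) ^+ j = q ^+ n * q ^+ (s * j).+1.
    by rewrite -exprM !exprS; ring.
  have -> : q * (q ^+ s) ^+ j = q ^+ (s * j).+1 by rewrite -exprM exprS.
  by rewrite -!exprM; congr (_ / _); ring.
have termE k : wp_term q (q ^+ n.+1) (q ^+ s) m k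
    = (1 - q) * alpha (q ^+ n) q s k.
  rewrite alphaE // mulrA qint_mul_one_sub /wp_term -exprM -exprS.
  rewrite mulnA [(s * 2)%N]mulnC.
  by congr (_ * _); apply: eq_bigr.
have := wp_sum (qn s) (qn n.+1) qs1 qqs1 (fun j _ => cqn j) m.
under eq_bigr do rewrite termE.
rewrite -mulr_sumr big_ord_recr /= -exprM -exprS -/n -qint_mul_one_sub.
pose U := \prod_(j < m) (1 - q * (q ^+ s) ^+ j).
(* Since s(j+1) - n = -(s(m-1-j) + 1), reversing the product gives [U] up to a sign and a
   monomial. *)
have -> : \prod_(j < m) (1 - q * (q ^+ s) ^+ j.+1 / q ^+ n.+1)
    = U * (-1) ^+ m / q ^+ (s * 'C(m, 2) + m).
  rewrite -mulrA.
  have -> : (-1) ^+ m / q ^+ (s * 'C(m, 2) + m)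
      = \prod_(j < m) (- (q ^+ (s * j).+1)^-1).
    elim: (m) => [|k IH]; first by rewrite big_ord0 muln0 expr0 divr1.
    rewrite big_ord_recr /= -{}IH binS bin1 mulnDr exprS.
    have -> : (s * 'C(k, 2) + s * k + k.+1 = s * 'C(k, 2) + k + (s * k).+1)%N.
      by lia.
    by rewrite [in LHS]exprD invfM; ring.
  rewrite /U -big_split /= (reindex_inj rev_ord_inj) /=.
  apply: eq_bigr => j _; rewrite -!exprM -!exprS subnSK //.
  have -> : q ^+ n.+1 = q ^+ (s * (m - j)).+1 * q ^+ (s * j).+1.
    by rewrite -exprD; congr (_ ^+ _); have := ltn_ord j; rewrite /n; nia.
  by rewrite invfM mulrA divff //; field.
move=> E.
have U0 : U != 0 by apply/prodf_neq0 => j _; rewrite -exprM -exprS q1.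
apply: (mulfI q11); apply: (mulfI U0).
have e2 : (-1) ^+ m * (-1) ^+ m = 1 :> F by rewrite -expr2 sqrr_sign.
have W0 := qn (s * 'C(m, 2) + m)%N.
move: E; rewrite -/U; move: (q ^+ (_ + _)) W0 ((-1) ^+ m) e2 => W W0 e e2 E.
transitivity ((1 - q) * (\sum_(0 <= k < m.+1) alpha (q ^+ n) q s k)
              * (U * e / W) * (e * W)); last by rewrite E; ring.
rewrite -[LHS]mulr1 -e2; field.
by rewrite W0.
Qed.

(** * Coefficients of powers *)

Lemma coef_exp_eq (R : nzRingType) (p r : {poly R}) (k : nat) :
  (forall i, (i <= k)%N -> p`_i = r`_i) ->
  forall N i, (i <= k)%N -> (p ^+ N)`_i = (r ^+ N)`_i.
Proof.
move=> pr; elim=> [|N IH] i ik; first by rewrite !expr0.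
rewrite !exprS !coefM; apply: eq_bigr => j _.
have ji : (j <= i)%N by rewrite -ltnS.
by rewrite pr ?IH // (leq_trans _ ik) // leq_subr.
Qed.

(** Turns [tsum] into a coefficient of the N-th power of a generating polynomial; any truncation
    degree above k gives the same coefficient. *)
Lemma coef_exp_poly (R : comNzRingType) (f : nat -> R) (N k M : nat) :
  (k < M)%N ->
  ((\poly_(i < M) f i) ^+ N)`_k =
  \sum_(i : {ffun 'I_N -> 'I_k.+1} | (\sum_(j < N) i j == k)%N)
    \prod_(j < N) f (i j).
Proof.
move=> kM.
rewrite (@coef_exp_eq _ _ (\poly_(i < k.+1) f i) k) // => [|i ik]; last first.
  by rewrite !coef_poly ltnS ik (leq_ltn_trans ik kM).
rewrite poly_def -[N in LHS]card_ord -prodr_const bigA_distr_bigA /=.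
rewrite coef_sum [RHS]big_mkcond /=; apply: eq_bigr => i _.
rewrite scaler_prod -expr_sum coefZ coefXn eq_sym.
by case: ifP; rewrite (mulr1, mulr0).
Qed.

(** As H has degree below d, the shifted copies X^(dl) H do not overlap. *)
Lemma coef_comp_Xn_mul (R : comNzRingType) (G H : {poly R}) (d k : nat) :
  (0 < d)%N -> (size H <= d)%N ->
  ((G \Po 'X^d) * H)`_k = G`_(k %/ d) * H`_(k %% d).
Proof.
move=> d0 Hd; rewrite coefM.
have kd : (k %/ d * d < k.+1)%N by rewrite ltnS leq_trunc_div.
rewrite (bigD1 (Ordinal kd)) //= coef_comp_poly_Xn // dvdn_mull // mulnK //.
rewrite {2}(divn_eq k d) addKn big1 ?addr0 // => j jk.
rewrite coef_comp_poly_Xn //; case: ifP => [dj|_]; last by rewrite mul0r.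
have [le_d | lt_d] := leqP d (k - j).
  by rewrite [H`_ _]nth_default ?mulr0 // (leq_trans Hd).
case/eqP: jk; apply: val_inj => /=.
rewrite -(divnK dj); congr (_ * _)%N.
have jk : (j <= k)%N by rewrite -ltnS.
have kE : k = (j %/ d * d + (k - j))%N by rewrite divnK // subnKC.
by rewrite [in RHS]kE divnMDl // [((k - j) %/ d)%N]divn_small // addn0.
Qed.

(** Each complete block of d coefficients contributes G_l times the coefficient sum H(1). *)
Lemma sum_coef_comp_Xn_mul (R : comNzRingType) (G H : {poly R}) (d r : nat) :
  (0 < d)%N -> (size H <= d)%N ->
  \sum_(0 <= k < r * d) ((G \Po 'X^d) * H)`_k
  = (\sum_(0 <= l < r) G`_l) * H.[1].
Proof.
move=> d0 Hd.
have H1 : H.[1] = \sum_(0 <= i < d) H`_i.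
  rewrite (horner_coef_wide _ Hd) big_mkord.
  by apply: eq_bigr => i _; rewrite expr1n mulr1.
elim: r => [|r IH]; first by rewrite mul0n !big_nil mul0r.
rewrite (@big_cat_nat _ _ _ (r * d)) ?leq_mul2r ?leqnSn ?orbT //= IH.
rewrite [in RHS]big_nat_recr //= mulrDl; congr (_ + _).
rewrite -{1}[(r * d)%N]add0n big_addn mulSn addnK H1 mulr_sumr.
rewrite !big_mkord; apply: eq_bigr => i _.
rewrite coef_comp_Xn_mul // addnC divnMDl // modnMDl.
by rewrite divn_small // modn_small // addn0.
Qed.

Lemma poly_periodic (R : comNzRingType) (c a : nat -> R) (d r : nat) :
  (0 < d)%N ->
  \poly_(i < r * d) (c (i %/ d)%N * a (i %% d)%N)
  = ((\poly_(l < r) c l) \Po 'X^d) * \poly_(i < d) a i.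
Proof.
move=> d0; apply/polyP => k.
rewrite coef_comp_Xn_mul ?size_poly // !coef_poly ltn_divLR // ltn_pmod //.
by case: ifP; rewrite ?mul0r.
Qed.

Lemma size_exp_poly_leq (R : nzRingType) (p : {poly R}) (N m : nat) :
  (size p <= m.+1)%N -> (size (p ^+ N) <= (N * m).+1)%N.
Proof.
move=> pm; apply: leq_trans (size_poly_exp_leq p N) _.
by rewrite ltnS mulnC leq_mul //; lia.
Qed.

Local Notation tofrac := FracField.tofrac.

(** * Specialization of fractions *)

Section Evaluation.
Variables (R : idomainType) (L : fieldType) (phi : {rmorphism R -> L}).
Implicit Types (f g : {fraction R}) (u v : L).

(* [phi] is defined at [f] (some denominator of [f] survives) and maps it to
   [v]. *)
Definition evaluates f v : Prop :=
  exists U V : R, [/\ phi V != 0, f = tofrac U / tofrac V & v = phi U / phi V].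

Lemma tofrac_eval_neq0 (V : R) : phi V != 0 -> tofrac V != 0.
Proof. by rewrite tofrac_eq0; apply: contraNneq => ->; rewrite rmorph0. Qed.

Lemma evaluates_tofrac (U : R) : evaluates (tofrac U) (phi U).
Proof. by exists U, 1; rewrite !rmorph1 !divr1 oner_neq0. Qed.

Lemma evaluates1 : evaluates 1 1.
Proof.
by rewrite -[X in evaluates X]tofrac1 -(rmorph1 phi); apply: evaluates_tofrac.
Qed.

Lemma evaluates0 : evaluates 0 0.
Proof.
by rewrite -[X in evaluates X]tofrac0 -(rmorph0 phi); apply: evaluates_tofrac.
Qed.

Lemma evaluatesD f g u v :
  evaluates f u -> evaluates g v -> evaluates (f + g) (u + v).
Proof.
case=> [U1 [V1 [h1 -> ->]]] [U2 [V2 [h2 -> ->]]].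
exists (U1 * V2 + U2 * V1), (V1 * V2); rewrite rmorphM mulf_neq0 //; split=> //.
  by rewrite tofracD !tofracM addf_div // tofrac_eval_neq0.
by rewrite rmorphD !rmorphM addf_div.
Qed.

Lemma evaluatesM f g u v :
  evaluates f u -> evaluates g v -> evaluates (f * g) (u * v).
Proof.
case=> [U1 [V1 [h1 -> ->]]] [U2 [V2 [h2 -> ->]]].
exists (U1 * U2), (V1 * V2); rewrite rmorphM mulf_neq0 //; split=> //.
  by rewrite !tofracM mulf_div.
by rewrite !rmorphM mulf_div.
Qed.

Lemma evaluatesN f u : evaluates f u -> evaluates (- f) (- u).
Proof.
case=> [U [V [h -> ->]]]; exists (- U), V; split=> //.
  by rewrite tofracN mulNr.
by rewrite rmorphN mulNr.
Qed.

Lemma evaluatesB f g u v :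
  evaluates f u -> evaluates g v -> evaluates (f - g) (u - v).
Proof. by move=> hf hg; apply: evaluatesD => //; apply: evaluatesN. Qed.

Lemma evaluatesV f u : u != 0 -> evaluates f u -> evaluates f^-1 u^-1.
Proof.
move=> u0 [U [V [h -> E]]]; exists V, U; rewrite E !invf_div; split=> //.
by apply: contraNneq u0 => U0; rewrite E U0 mul0r.
Qed.

Lemma evaluates_div f g u v : v != 0 ->
  evaluates f u -> evaluates g v -> evaluates (f / g) (u / v).
Proof. by move=> v0 hf hg; apply: evaluatesM => //; apply: evaluatesV. Qed.

Lemma evaluatesX f u n : evaluates f u -> evaluates (f ^+ n) (u ^+ n).
Proof.
move=> hf; elim: n => [|n IH]; first by rewrite !expr0; apply: evaluates1.
by rewrite !exprS; apply: evaluatesM.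
Qed.

Lemma evaluates_sum (I : Type) (r : seq I) (P : pred I) F G :
  (forall i, P i -> evaluates (F i) (G i)) ->
  evaluates (\sum_(i <- r | P i) F i) (\sum_(i <- r | P i) G i).
Proof.
move=> FG; apply: (big_ind2 evaluates) => // [|*]; first exact: evaluates0.
exact: evaluatesD.
Qed.

Lemma evaluates_prod (I : Type) (r : seq I) (P : pred I) F G :
  (forall i, P i -> evaluates (F i) (G i)) ->
  evaluates (\prod_(i <- r | P i) F i) (\prod_(i <- r | P i) G i).
Proof.
move=> FG; apply: (big_ind2 evaluates) => // [|*]; first exact: evaluates1.
exact: evaluatesM.
Qed.

Lemma evaluates_qint f u n : evaluates f u -> evaluates (qint f n) (qint u n).
Proof. by move=> hf; apply: evaluates_sum => i _; apply: evaluatesX. Qed.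

End Evaluation.

(** No specialization of the family kills both terms of the reduced fraction, since the generator of
    its kernel would be a common nonunit divisor. Hence all of them kill the numerator and none
    kills the denominator. *)
Lemma congr_frac_eval (R : idomainType) (L : fieldType)
    (fam : {rmorphism R -> L} -> Prop) (A B : {fraction R}) (P : R) :
  P != 0 ->
  (forall a, (forall phi, fam phi -> phi a = 0) -> rdvd P a) ->
  (forall phi, fam phi -> phi P = 0) ->
  (forall phi, fam phi ->
     exists2 p, phi p = 0 & forall a, phi a = 0 -> rdvd p a) ->
  (exists A1 A2 : R,
     [/\ A2 != 0, A - B = tofrac A1 / tofrac A2 & rcoprime A1 A2]) ->
  (forall phi, fam phi -> evaluates phi (A - B) 0) ->
  congr_frac A B P.
Proof.
move=> P0 Pdvd Pker kerp [A1 [A2 [A20 AB cop]]] ev0.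
have kerA1 phi : fam phi -> phi A1 = 0.
  move=> fphi; have [U [V [V0 E /esym/eqP]]] := ev0 phi fphi.
  rewrite mulf_eq0 invr_eq0 (negPf V0) orbF => /eqP U0.
  move/eqP: E; rewrite AB eqr_div ?tofrac_eq0 //; last first.
    by apply: contraNneq V0 => ->; rewrite rmorph0.
  rewrite -!tofracM tofrac_eq => /eqP/(congr1 phi).
  rewrite !rmorphM U0 mul0r => /eqP.
  by rewrite mulf_eq0 (negPf V0) orbF => /eqP.
have kerA2 phi : fam phi -> phi A2 != 0.
  move=> fphi; have [p p0 kp] := kerp phi fphi.
  apply/eqP => A2z; have : p \is a GRing.unit.
    by apply: cop; apply: kp; rewrite ?kerA1.
  by move/(rmorph_unit phi); rewrite p0 unitr0.
exists A1, A2; split=> //; first exact: Pdvd.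
move=> d [e PE] [f A2E].
(* The product A2 e = f P is killed while A2 is not, so e is killed; then P divides its own cofactor
   e, which makes d a unit. *)
have [g gE] : rdvd P e.
  apply: Pdvd => phi fphi; have /eqP := congr1 phi (congr1 ( *%R^~ e) A2E).
  have -> : f * d * e = f * P by rewrite PE; ring.
  by rewrite !rmorphM Pker // mulr0 mulf_eq0 (negPf (kerA2 _ fphi)) => /eqP.
apply/unitrPr; exists g; apply: (mulfI P0).
by rewrite mulr1 mulrCA [P * g]mulrC -gE mulrC -PE.
Qed.

(** * Lowest terms of bivariate fractions *)

Lemma tofrac_div_surj (R : idomainType) (f : {fraction R}) :
  exists a b, b != 0 /\ f = tofrac a / tofrac b.
Proof.
elim/quotW: f => x; exists \n_x, \d_x; split; first exact: denom_ratioP.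
have dx := denom_ratioP x.
apply: (canRL (mulfK _)); first by rewrite tofrac_eq0.
rewrite -[x in LHS]Ratio_numden !piE; apply/eqmodP.
rewrite /= FracField.equivfE !numden_Ratio ?mulr1 ?mul1r ?oner_neq0 //.
by rewrite mulrC.
Qed.

(** Descent on the outer degree of the denominator plus the degree of its leading coefficient: both
    add under multiplication, and both are zero only for units. *)
Lemma lowest_terms (F : fieldType) (f : {fraction {poly {poly F}}}) :
  exists A1 A2 : {poly {poly F}},
    [/\ A2 != 0, f = tofrac A1 / tofrac A2 & rcoprime A1 A2].
Proof.
have [a [b [b0 ->]]] := tofrac_div_surj f.
pose mu (p : {poly {poly F}}) := (size p + size (lead_coef p))%N.
have [m] := ubnP (mu b); elim: m a b b0 => // m IH a b b0 mub.
have [cop|ncop] := classic (rcoprime a b); first by exists a, b.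
have [d [[a' aE] [b' bE] du]] :
    exists d, [/\ rdvd d a, rdvd d b & d \isn't a GRing.unit].
  apply: NNPP => nex; apply: ncop => d da db.
  by apply: contra_notT nex => du; exists d.
have [b'0 d0] : b' != 0 /\ d != 0.
  by move: b0; rewrite bE mulf_eq0 negb_or => /andP[].
have -> : tofrac a / tofrac b = tofrac a' / tofrac b'.
  by rewrite aE bE !tofracM -mulf_div divff ?mulr1 // tofrac_eq0.
apply: IH => //; rewrite -ltnS; apply: leq_trans mub; rewrite ltnS bE /mu.
rewrite size_mul // lead_coefM size_mul ?lead_coef_eq0 //.
have := size_poly_gt0 d; have := size_poly_gt0 (lead_coef d).
rewrite lead_coef_eq0 d0.
have := size_poly_gt0 b'; have := size_poly_gt0 (lead_coef b').
rewrite lead_coef_eq0 b'0.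
suff : (2 < size d + size (lead_coef d))%N.
  by move: (size b') (size d) (size (lead_coef b')) (size (lead_coef d)); lia.
rewrite ltnNge; apply: contra du => du.
have lcd : size (lead_coef d) = 1%N /\ size d = 1%N.
  have := size_poly_gt0 d; have := size_poly_gt0 (lead_coef d).
  rewrite lead_coef_eq0 d0; move: du.
  by move: (size d) (size (lead_coef d)); lia.
case: lcd => lcd sd; have d0E : lead_coef d = d`_0 by rewrite lead_coefE sd.
have lE : lead_coef (lead_coef d) = (lead_coef d)`_0.
  by rewrite [LHS]lead_coefE lcd.
by rewrite poly_unitE sd -d0E poly_unitE lcd -lE unitfE !lead_coef_eq0.
Qed.

(** * The specializations that detect the modulus *)

Lemma rdvd_polyC (F : fieldType) (p : {poly F}) (a : {poly {poly F}}) :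
  (forall i, p %| a`_i) -> rdvd p%:P a.
Proof.
move=> pa; exists (\poly_(i < size a) (a`_i %/ p)).
apply/polyP => i; rewrite coefMC coef_poly.
by case: ltnP => [_ | /(nth_default 0) ->]; rewrite ?divpK ?mul0r.
Qed.

(** The leading coefficient of 1 - cX may fail to be invertible, but its constant coefficient is 1,
    so reduction runs upward from low degree: 1 is replaced by (cX)^(D+1), and the remainder is a
    monomial. *)
Lemma poly_mod_one_subCX (R : comNzRingType) (c : R) (p : {poly R}) :
  exists (g : {poly R}) (b : R) (D : nat), p = g * (1 - c *: 'X) + b *: 'X^D.
Proof.
elim/poly_ind: p => [|p e [g [b [D ->]]]].
  by exists 0, 0, 0%N; rewrite mul0r scale0r addr0.
exists (g * 'X + e *: \sum_(i < D.+1) (c *: 'X) ^+ i).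
exists (b + e * c ^+ D.+1), D.+1.
have E : (e *: \sum_(i < D.+1) (c *: 'X) ^+ i) * (1 - c *: 'X)
    = e *: (1 - c ^+ D.+1 *: 'X ^+ D.+1) :> {poly R}.
  by rewrite -scalerAl mulrC -opprB mulNr -subrX1 opprB exprZn.
rewrite !mulrDl E -!mul_polyC !rmorphD !rmorphM !rmorphXn /= !exprS; ring.
Qed.

(** At the root 1/c the monomial remainder b X^D takes the value b c^-D, which is zero only if b
    is. *)
Lemma rdvd_one_subCX (F : fieldType) (R : idomainType)
    (f : {rmorphism R -> F}) (c : R) (p : {poly R}) :
  injective f -> c != 0 -> (map_poly f p).[(f c)^-1] = 0 ->
  rdvd (1 - c *: 'X) p.
Proof.
move=> finj c0; have [g [b [D ->]]] := poly_mod_one_subCX c p.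
have fc0 : f c != 0 by rewrite -(rmorph0 f) (inj_eq finj).
rewrite rmorphD !rmorphM rmorphB rmorph1 /= !map_polyZ map_polyX map_polyXn /=.
rewrite !hornerE divff // subrr mulr0 add0r => /eqP.
rewrite mulf_eq0 expf_eq0 invr_eq0 (negPf fc0) andbF orbF.
rewrite -(rmorph0 f) (inj_eq finj) => /eqP ->.
by exists g; rewrite scale0r addr0.
Qed.

Local Notation pQtoC := (map_poly (ratr : rat -> algC)).

(** Multiplied by X - 1, [n] becomes X^n - 1, which splits into distinct linear factors over [algC];
    divisibility descends to the rationals. *)
Lemma qint_dvdp (n : nat) (f : {poly rat}) : (0 < n)%N ->
  (forall z : algC, z ^+ n = 1 -> z != 1 -> root (pQtoC f) z) ->
  qint 'X n %| f.
Proof.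
move=> n0 fz; have [w prw] := C_prim_root_exists n0.
have X1 : 'X - 1 != 0 :> {poly rat} by rewrite polyXsubC_eq0.
rewrite -(dvdp_mul2l _ _ X1) -subrX1.
rewrite -(dvdp_map (ratr : {rmorphism rat -> algC})).
rewrite rmorphB rmorph1 /= map_polyXn -(factor_Xn_sub_1 prw).
rewrite -(big_map (fun i => w ^+ i) xpredT (fun y => 'X - y%:P)).
apply: uniq_roots_dvdp.
  apply/allP => y /mapP[i _ ->{y}].
  rewrite rmorphM rmorphB rmorph1 /= map_polyX rootM root_XsubC.
  case: eqP => //= /eqP wi1; apply: fz => //.
  by rewrite exprAC (prim_expr_order prw) expr1n.
rewrite uniq_rootsE map_inj_in_uniq ?iota_uniq // => i j.
rewrite !mem_index_iota /= => ltin ltjn /eqP.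
by rewrite (eq_prim_root_expr prw) !modn_small // => /eqP.
Qed.

Local Notation Lx := {fraction {poly algC}}.
Definition genL : Lx := tofrac 'X.

(* The specializations q = z, x = X and q = X, x = x0. *)
Definition spec_q (z : algC) : {rmorphism Qqx -> Lx} :=
  (@FracField.tofrac _ \o map_poly (horner_eval z \o pQtoC)).
Definition emb_q : {rmorphism {poly rat} -> Lx} :=
  (@FracField.tofrac _ \o pQtoC).
Definition spec_x (x0 : Lx) : {rmorphism Qqx -> Lx} :=
  (horner_eval x0 \o map_poly emb_q).

Lemma emb_q_inj : injective emb_q.
Proof.
move=> u v /= /eqP; rewrite tofrac_eq => /eqP.
exact: (map_poly_inj (ratr : {rmorphism rat -> algC})).
Qed.

Lemma spec_q_pq z : spec_q z pq = tofrac z%:P.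
Proof. by rewrite /= map_polyC /= map_polyX /horner_eval hornerX. Qed.

Lemma spec_q_px z : spec_q z px = genL.
Proof. by rewrite /= map_polyX. Qed.

Lemma spec_x_pq x0 : spec_x x0 pq = genL.
Proof. by rewrite /= map_polyC /= map_polyX /horner_eval hornerC. Qed.

Lemma spec_x_px x0 : spec_x x0 px = x0.
Proof. by rewrite /= map_polyX /horner_eval hornerX. Qed.

Lemma spec_q_eq0 z a : spec_q z a = 0 -> forall i, root (pQtoC a`_i) z.
Proof.
move=> /eqP; rewrite /= tofrac_eq0 => /eqP/polyP a0 i.
by move: (a0 i); rewrite coef_map coef0 => /eqP.
Qed.

Lemma genL_neq0 : genL != 0.
Proof. by rewrite tofrac_eq0 polyX_eq0. Qed.

Lemma genL_exp_neq1 j : (0 < j)%N -> 1 - genL ^+ j != 0.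
Proof.
move=> j0; rewrite /genL -tofracXn -tofrac1 -tofracB tofrac_eq0 -opprB oppr_eq0.
by rewrite -size_poly_eq0 size_Xn_sub_1.
Qed.

Lemma spec_q_pq_expn z n : z ^+ n = 1 -> spec_q z pq ^+ n = 1.
Proof. by move=> zn; rewrite spec_q_pq -tofracXn -rmorphXn zn. Qed.

Lemma spec_q_pq_neq1 z : z != 1 -> spec_q z pq != 1.
Proof.
move=> z1.
by rewrite spec_q_pq -tofrac1 tofrac_eq -polyC1 (inj_eq (@polyC_inj _)).
Qed.

Lemma Lx_natr_neq0 k : k.+1%:R != 0 :> Lx.
Proof.
rewrite -(rmorph_nat (@FracField.tofrac _)) tofrac_eq0 -polyC_natr polyC_eq0.
by rewrite Num.Theory.pnatr_eq0.
Qed.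

Definition modulus (n : nat) : Qqx :=
  qint pq n * (1 - px * pq ^+ n) * (px - pq ^+ n).

Definition roots_fam (n : nat) (phi : {rmorphism Qqx -> Lx}) : Prop :=
  [\/ exists z, [/\ z ^+ n = 1, z != 1 & phi = spec_q z],
      phi = spec_x (genL ^+ n) | phi = spec_x (genL ^+ n)^-1].

Lemma qint_polyC (n : nat) : qint pq n = (qint 'X n)%:P.
Proof.
by rewrite /qint rmorph_sum; apply: eq_bigr => i _; rewrite rmorphXn.
Qed.

(** The three factors are split off one after another: a factor already removed is nonzero at the
    remaining points, so the quotient still vanishes there. *)
Lemma modulus_dvd (n : nat) (a : Qqx) : (0 < n)%N ->
  (forall phi, roots_fam n phi -> phi a = 0) -> rdvd (modulus n) a.
Proof.
move=> n0 a0.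
have [b bE] : rdvd (qint pq n) a.
  rewrite qint_polyC; apply: rdvd_polyC => i; apply: qint_dvdp => // z zn z1.
  by apply: spec_q_eq0; apply: a0; apply: Or31; exists z.
have tn0 : genL ^+ n != 0 by rewrite expf_neq0 ?genL_neq0.
have qn0 x0 : spec_x x0 (qint pq n) != 0.
  apply/eqP => /(congr1 ( *%R (genL - 1))); rewrite mulr0 /qint rmorph_sum.
  under eq_bigr do rewrite rmorphXn spec_x_pq.
  rewrite -subrX1; apply/eqP.
  by rewrite -opprB oppr_eq0 genL_exp_neq1.
have b0 x0 : roots_fam n (spec_x x0) -> spec_x x0 b = 0.
  move/a0; rewrite bE rmorphM => /eqP.
  by rewrite mulf_eq0 (negPf (qn0 _)) orbF => /eqP.
have [c cE] : rdvd (px - pq ^+ n) b.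
  have /factor_theorem[c cE] : root b ('X ^+ n).
    have := b0 _ (Or32 _ _ (erefl _)).
    have -> : genL ^+ n = emb_q ('X ^+ n) by rewrite rmorphXn /= map_polyX.
    rewrite [spec_x _ _]/= /horner_eval horner_map => /eqP.
    by rewrite -(rmorph0 emb_q) (inj_eq emb_q_inj).
  by exists c; rewrite cE rmorphXn.
have [d dE] : rdvd (1 - px * pq ^+ n) c.
  have -> : px * pq ^+ n = 'X ^+ n *: 'X by rewrite -mul_polyC rmorphXn mulrC.
  have XE : emb_q ('X ^+ n) = genL ^+ n by rewrite rmorphXn /= map_polyX.
  apply: (rdvd_one_subCX emb_q_inj); first by rewrite expf_neq0 // polyX_eq0.
  have := b0 _ (Or33 _ _ (erefl _)).
  rewrite cE rmorphM => /eqP; rewrite mulf_eq0 => /orP[|].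
    by rewrite XE => /eqP.
  rewrite rmorphB rmorphXn spec_x_px spec_x_pq.
  (* The removed factor x - q^n is nonzero at x = q^-n because q^(2n) differs from 1. *)
  have -> : (genL ^+ n)^-1 - genL ^+ n = (genL ^+ n)^-1 * (1 - genL ^+ (n + n)).
    by rewrite exprD mulrBr mulr1 mulKf.
  rewrite mulf_eq0 invr_eq0 (negPf tn0) (negPf (genL_exp_neq1 _)) //.
  by rewrite addn_gt0 n0.
by exists d; rewrite bE cE dE /modulus; ring.
Qed.

Lemma qint_root_eq0 (F : fieldType) (z : F) (n : nat) :
  z ^+ n = 1 -> z != 1 -> qint z n = 0.
Proof.
rewrite -subr_eq0 => zn z1; apply: (mulfI z1).
by rewrite mulr0 -subrX1 zn subrr.
Qed.

Lemma rmorph_qint (R S : nzRingType) (f : {rmorphism R -> S}) (q : R)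
    (n : nat) :
  f (qint q n) = qint (f q) n.
Proof. by rewrite rmorph_sum; apply: eq_bigr => i _; rewrite rmorphXn. Qed.

Lemma roots_fam_modulus (n : nat) phi : roots_fam n phi -> phi (modulus n) = 0.
Proof.
rewrite /modulus !rmorphM !rmorphB rmorph1 rmorphM rmorphXn rmorph_qint.
case=> [[z [zn z1 ->]]|->|->].
- rewrite qint_root_eq0 ?mul0r //; first exact: spec_q_pq_expn.
  exact: spec_q_pq_neq1.
- by rewrite spec_x_px spec_x_pq subrr mulr0.
- rewrite spec_x_px spec_x_pq mulVf ?subrr ?(mulr0, mul0r) //.
  by rewrite expf_neq0 ?genL_neq0.
Qed.

(** The generators are the minimal polynomial of z over the rationals, x - q^n and 1 - x q^n. *)
Lemma roots_fam_ker (n : nat) phi : roots_fam n phi ->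
  exists2 p, phi p = 0 & forall a, phi a = 0 -> rdvd p a.
Proof.
have XE : emb_q ('X ^+ n) = genL ^+ n by rewrite rmorphXn /= map_polyX.
case=> [[z [zn z1 ->]]|->|->].
- have [p [_ _ rootp]] := minCpolyP z.
  exists p%:P => [|a /spec_q_eq0 az]; last first.
    by apply: rdvd_polyC => i; rewrite -rootp.
  rewrite /= map_polyC /= [horner_eval _ _](eqP (_ : root _ z)) ?tofrac0 //.
  by rewrite rootp.
- exists (px - pq ^+ n) => [|a].
    by rewrite rmorphB rmorphXn spec_x_px spec_x_pq subrr.
  rewrite -XE [spec_x _ _]/= /horner_eval horner_map -(rmorph0 emb_q).
  move/emb_q_inj/eqP/factor_theorem => [c cE].
  by exists c; rewrite cE rmorphXn.
- have cE : 1 - px * pq ^+ n = 1 - 'X ^+ n *: 'X.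
    by rewrite -mul_polyC rmorphXn mulrC.
  exists (1 - px * pq ^+ n) => [|a a0].
    rewrite rmorphB rmorph1 rmorphM rmorphXn spec_x_px spec_x_pq.
    by rewrite mulVf ?subrr // expf_neq0 ?genL_neq0.
  rewrite cE; apply: (rdvd_one_subCX emb_q_inj).
    by rewrite expf_neq0 // polyX_eq0.
  by rewrite XE.
Qed.

Lemma modulus_neq0 (n : nat) : (0 < n)%N -> modulus n != 0.
Proof.
(* At x = 0 the modulus becomes -[n] q^n. *)
move=> n0; apply/eqP => /(congr1 (spec_x 0)); apply/eqP.
rewrite /modulus !rmorphM !rmorphB rmorph1 rmorphM rmorphXn rmorph_qint.
rewrite spec_x_px spec_x_pq rmorph0 mul0r subr0 sub0r mulr1.
apply: mulf_neq0; last first.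
  by rewrite oppr_eq0; apply: expf_neq0; apply: genL_neq0.
apply/eqP => q0; have := subrX1 genL n; rewrite -/(qint genL n) q0 mulr0.
move/eqP; rewrite -opprB oppr_eq0; apply/negP.
exact: genL_exp_neq1.
Qed.

(** * The summand at a root of unity *)

Section RootOfUnity.
Variables (F : fieldType) (z x : F) (s m : nat).
Let d := (s * m).+1.
Hypotheses (s0 : (0 < s)%N) (prz : d.-primitive_root z).
Hypotheses (x0 : x != 0) (xd : x ^+ d != 1).

Let z0 : z != 0.
Proof. by have := prim_root_eq0 prz; rewrite /d => ->. Qed.

Let zn0 e : z ^+ e != 0.
Proof. by rewrite expf_neq0. Qed.

Let zM e : z ^+ (d * e) = 1.
Proof. by rewrite exprM (prim_expr_order prz) expr1n. Qed.

Lemma one_sub_xz_neq0 e : 1 - x * z ^+ e != 0.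
Proof.
rewrite subr_eq0 eq_sym; apply: contraNneq xd => xz.
by rewrite -(mulr1 (x ^+ d)) -{1}(zM e) mulnC exprM -exprMn xz expr1n.
Qed.

Lemma one_sub_zVx_neq0 e : 1 - z ^+ e / x != 0.
Proof.
rewrite -(divff x0) -mulrBl mulf_neq0 ?invr_eq0 // subr_eq0.
apply: contraNneq xd => ->.
by rewrite -exprM mulnC zM.
Qed.

Lemma one_sub_z_neq0 e : ~~ (d %| e)%N -> 1 - z ^+ e != 0.
Proof. by rewrite (prim_order_dvd prz) subr_eq0 eq_sym. Qed.

Lemma coprime_ds : coprime d s.
Proof. by rewrite /d -addn1 mulnC /coprime gcdnC gcdnMDl gcdn1. Qed.

Lemma ndvd_d_succ j : (j < m)%N -> ~~ (d %| (s * j).+1)%N.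
Proof. by move=> jm; rewrite gtnNdvd // /d ltnS ltn_mul2l s0. Qed.

Lemma ndvd_d_mul j : (j.+1 < d)%N -> ~~ (d %| s * j.+1)%N.
Proof. by move=> jd; rewrite Gauss_dvdr ?coprime_ds // gtnNdvd. Qed.

Lemma alpha_step_periodic l j :
  alpha_step x z s (l * d + j) = alpha_step x z s j.
Proof.
clear x0 xd; have E e e' : (e = d * (s * l) + e')%N -> z ^+ e = z ^+ e'.
  by move=> ->; rewrite exprD zM mul1r.
rewrite /alpha_step; congr (- _ * _ / _).
- by apply: E; rewrite !mulnS mulnDr; lia.
- by congr ((1 - x * _) * (1 - _ / x) * (1 - _)); apply: E; rewrite mulnDr; lia.
- congr ((1 - x * _) * (1 - _ / x) * (1 - _)); apply: E;
  by rewrite !mulnS mulnDr; lia.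
Qed.

Let num j := (1 - x * z ^+ (s * j).+1) * (1 - z ^+ (s * j).+1 / x)
             * (1 - z ^+ (s * j).+1).

Let num_neq0 j : (j < m)%N -> num j != 0.
Proof.
move=> jm; rewrite !mulf_neq0 ?one_sub_xz_neq0 ?one_sub_zVx_neq0 //.
exact/one_sub_z_neq0/ndvd_d_succ.
Qed.

Let den j := (1 - x * z ^+ (s * j.+1)) * (1 - z ^+ (s * j.+1) / x)
             * (1 - z ^+ (s * j.+1)).

(** Since s(m-j) + (sj+1) = d, the powers z^(s(m-j)) and z^(sj+1) are inverse to each other;
    reversal thus exchanges numerators and denominators up to a monomial. *)
Let den_rev j : (j < m)%N ->
  den (m - j.+1) = - num j / z ^+ (3 * (s * j).+1).
Proof.
move=> jm; rewrite /den /num subnSK //.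
have -> : z ^+ (s * (m - j)) = (z ^+ (s * j).+1)^-1.
  apply: (mulIf (zn0 (s * j).+1)); rewrite mulVf // -exprD -[RHS](zM 1).
  by congr (_ ^+ _); rewrite /d; nia.
rewrite [(3 * _)%N]mulnC exprM; field.
by rewrite x0 zn0.
Qed.

Let stepE j : alpha_step x z s j = - z ^+ (s * j.+1).-1 * num j / den j.
Proof. by []. Qed.

Let den_neq0 j : (j < m)%N -> den j != 0.
Proof.
move=> jm; have mj : (m - j.+1 < m)%N by lia.
have -> : j = (m - (m - j.+1).+1)%N by lia.
by rewrite den_rev // mulNr oppr_eq0 mulf_neq0 ?invr_eq0 ?num_neq0.
Qed.

Lemma alpha_step_rev k : (k < m)%N ->
  alpha_step x z s (m - k.+1) * alpha_step x z s k * z ^+ (2 * s) = 1.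
Proof.
move=> km; rewrite !stepE den_rev //.
have mk : (m - k.+1 < m)%N by lia.
have -> : num (m - k.+1) = - den k * z ^+ (3 * (s * (m - k.+1)).+1).
  have kE : k = (m - (m - k.+1).+1)%N by lia.
  by rewrite [X in den X]kE den_rev // mulNr mulfVK // opprK.
have nk := num_neq0 km; have dk := den_neq0 km.
have -> : - z ^+ (s * (m - k.+1).+1).-1
    * (- den k * z ^+ (3 * (s * (m - k.+1)).+1))
    / (- num k / z ^+ (3 * (s * k).+1))
    * (- z ^+ (s * k.+1).-1 * num k / den k) * z ^+ (2 * s)
  = z ^+ ((s * (m - k.+1).+1).-1 + 3 * (s * (m - k.+1)).+1 + 3 * (s * k).+1
          + (s * k.+1).-1 + 2 * s).
  rewrite !exprD.
  move: (z ^+ _) (z ^+ (3 * (s * k).+1)) (zn0 (3 * (s * k).+1)) => A C C0.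
  move: (num k) (den k) nk dk => N D N0 D0.
  by field; rewrite oppr_eq0 N0 D0 C0.
(* The exponents add up to 4d. *)
rewrite -[RHS](zM 4); congr (_ ^+ _); rewrite /d.
nia.
Qed.

(** Numerator j is paired with denominator m-1-j, leaving a monomial. The exponents add up to 2md -
    sm, and z^(-sm) = z. *)
Lemma prod_alpha_step_half : \prod_(j < m) alpha_step x z s j = z.
Proof.
have -> : \prod_(j < m) alpha_step x z s j
    = \prod_(j < m) z ^+ ((s * j.+1).-1 + 3 * (s * j).+1).
  under eq_bigr do rewrite stepE.
  rewrite big_split /= prodfV [X in _ / X](reindex_inj rev_ord_inj) /=.
  rewrite -prodf_div; apply: eq_bigr => j _.
  rewrite den_rev // exprD; have := num_neq0 (ltn_ord j).
  move: (z ^+ (3 * _)) (zn0 (3 * (s * j).+1)) (num j) => C C0 N N0.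
  by field; rewrite oppr_eq0 N0 C0.
apply: (mulIf (zn0 (s * m))); rewrite -exprS (prim_expr_order prz).
rewrite prodrXr -exprD -[RHS](zM (2 * m)); congr (_ ^+ _); rewrite /d.
elim: (m) => [|k IH]; first by rewrite big_ord0 !muln0.
rewrite big_ord_recr /= !mulnS; move: IH.
move: (\sum_(_ < k) _)%N => e; have := s0; nia.
Qed.

Lemma prod_alpha_step_rev k : (k <= m)%N ->
  \prod_(j < m - k) alpha_step x z s j
  = (\prod_(j < k) alpha_step x z s j) * z ^+ (2 * s * k).+1.
Proof.
elim: k => [|k IH] km.
  by rewrite subn0 big_ord0 mul1r muln0 expr1 prod_alpha_step_half.
have := IH (ltnW km); rewrite -(subnSK km) !big_ord_recr /= => E.
have R := alpha_step_rev km.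
set A := alpha_step x z s (m - k.+1) in E R.
have A0 : A != 0.
  by apply: contra_eq_neq R => ->; rewrite !mul0r eq_sym oner_neq0.
apply: (mulIf A0); rewrite E -[LHS]mulr1 -{}R.
have -> : (2 * s * k.+1).+1 = ((2 * s * k).+1 + 2 * s)%N by lia.
by rewrite exprD; ring.
Qed.

(** Step m contains 1 - z^(sm+1) = 0. For large k other steps may divide by zero; this yields 0 and
    keeps the product zero. *)
Lemma alpha_gt_half k : (m < k)%N -> alpha x z s k = 0.
Proof.
move=> mk; rewrite alphaE // (bigD1 (Ordinal mk)) //= stepE /num.
by rewrite (prim_expr_order prz) subrr !(mulr0, mul0r).
Qed.

Lemma sum_alpha_half : (1 < d)%N -> (2 : F) != 0 ->
  \sum_(0 <= k < m.+1) alpha x z s k = 0.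
Proof.
move=> d1 two0; set S := \sum_(_ <= _ < _) _.
have z1 : z - 1 != 0.
  by rewrite -opprB oppr_eq0 -[z]expr1 one_sub_z_neq0 // gtnNdvd.
suff SN : S = - S.
  apply/eqP; have : (2 : F) * S == 0.
    by rewrite mulr_natl mulr2n {2}SN subrr.
  by rewrite mulf_eq0 (negPf two0).
rewrite /S -sumrN big_mkord (reindex_inj rev_ord_inj) /= big_mkord.
apply: eq_bigr => i _; rewrite subSS !alphaE //.
have im : (i <= m)%N by rewrite -ltnS.
rewrite prod_alpha_step_rev // mulrCA mulrC -mulNr; congr (_ * _).
(* Multiplied by z - 1, the claim reads z^(2d) - z^(2si+1) = 1 - z^(2si+1). *)
apply: (mulfI z1); rewrite mulrA -subrX1 mulrN -subrX1 mulrBl mul1r -exprD.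
have -> : ((2 * s * (m - i)).+1 + (2 * s * i).+1 = d * 2)%N by rewrite /d; nia.
by rewrite zM opprB.
Qed.

End RootOfUnity.

(** * Specialization of the summand *)

Section EvaluateAlpha.
Variables (L : fieldType) (phi : {rmorphism Qqx -> L}) (s : nat).
Let z := phi pq.
Let x := phi px.
Hypotheses (s0 : (0 < s)%N) (x0 : x != 0).

Lemma evaluates_fq e : evaluates phi (fq ^+ e) (z ^+ e).
Proof. exact/evaluatesX/evaluates_tofrac. Qed.

Lemma evaluates_one_sub_fq e : evaluates phi (1 - fq ^+ e) (1 - z ^+ e).
Proof. exact: evaluatesB (evaluates1 phi) (evaluates_fq e). Qed.

Lemma evaluates_one_sub_fxq e :
  evaluates phi (1 - fx * fq ^+ e) (1 - x * z ^+ e).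
Proof.
apply: evaluatesB (evaluates1 phi) (evaluatesM _ (evaluates_fq e)).
exact: evaluates_tofrac.
Qed.

Lemma evaluates_one_sub_fqVx e :
  evaluates phi (1 - fq ^+ e / fx) (1 - z ^+ e / x).
Proof.
apply: evaluatesB (evaluates1 phi) (evaluates_div x0 (evaluates_fq e) _).
exact: evaluates_tofrac.
Qed.

Lemma evaluates_alpha_step j :
  1 - x * z ^+ (s * j.+1) != 0 -> 1 - z ^+ (s * j.+1) / x != 0 ->
  1 - z ^+ (s * j.+1) != 0 ->
  evaluates phi (alpha_step fx fq s j) (alpha_step x z s j).
Proof.
move=> h1 h2 h3; apply: evaluates_div; first by rewrite !mulf_neq0.
  apply: evaluatesM; first exact/evaluatesN/evaluates_fq.
  apply: evaluatesM (evaluates_one_sub_fq _).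
  exact: evaluatesM (evaluates_one_sub_fxq _) (evaluates_one_sub_fqVx _).
apply: evaluatesM (evaluates_one_sub_fq _).
exact: evaluatesM (evaluates_one_sub_fxq _) (evaluates_one_sub_fqVx _).
Qed.

Lemma fq_neq0 : fq != 0.
Proof. by rewrite tofrac_eq0 polyC_eq0 polyX_eq0. Qed.

Lemma one_sub_fq_neq0 e : (0 < e)%N -> 1 - fq ^+ e != 0.
Proof.
move=> e0; rewrite /fq /pq -tofracXn -tofrac1 -tofracB tofrac_eq0.
rewrite -rmorphXn -polyC1 -rmorphB polyC_eq0 -opprB oppr_eq0.
by rewrite -size_poly_eq0 size_Xn_sub_1.
Qed.

Lemma evaluates_sum_tsum (N n : nat) (f : nat -> L) :
  (forall k, (k < n)%N -> evaluates phi (alpha fx fq s k) (f k)) ->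
  evaluates phi (\sum_(0 <= k < n) tsum fx fq s N k)
    (\sum_(0 <= k < n) ((\poly_(i < n) f i) ^+ N)`_k).
Proof.
move=> hf; rewrite !big_mkord; apply: evaluates_sum => k _.
rewrite coef_exp_poly //; apply: evaluates_sum => i _.
apply: evaluates_prod => j _; apply: hf.
by apply: leq_ltn_trans (ltn_ord k); rewrite -ltnS.
Qed.

Section Root.
Variable m : nat.
Let d := (s * m).+1.
Hypotheses (prz : d.-primitive_root z) (xd : x ^+ d != 1).
Hypothesis char0 : forall k, k.+1%:R != 0 :> L.

Definition regular f := exists v, evaluates phi f v.

Lemma regularM f g : regular f -> regular g -> regular (f * g).
Proof. by case=> u hu [v hv]; exists (u * v); apply: evaluatesM. Qed.

Lemma regular_prod (I : Type) (r : seq I) (P : pred I) F :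
  (forall i, P i -> regular (F i)) -> regular (\prod_(i <- r | P i) F i).
Proof.
move=> hF; apply: big_ind => // [|*]; last exact: regularM.
by exists 1; apply: evaluates1.
Qed.

(* Over a full period one numerator factor and one denominator factor vanish at
   the root of unity; their quotient is a quotient of q^d-integers. *)
Lemma regular_period l :
  regular (\prod_(i < d) alpha_step fx fq s (l * d + i)).
Proof.
pose A j := (1 - fx * fq ^+ (s * j).+1) * (1 - fq ^+ (s * j).+1 / fx).
pose B j := (1 - fx * fq ^+ (s * j.+1)) * (1 - fq ^+ (s * j.+1) / fx).
pose N j := 1 - fq ^+ (s * j).+1.
pose D j := 1 - fq ^+ (s * j.+1).
have stepE j : alpha_step fx fq s j
    = (- fq ^+ (s * j.+1).-1 * A j / B j) * (N j / D j).
  rewrite /alpha_step -/(A j) -/(B j) -/(N j) -/(D j) invfM.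
  by rewrite mulrA mulrACA !mulrA.
under eq_bigr do rewrite stepE.
rewrite big_split /=; apply: regularM.
  apply: regular_prod => i _; eexists; apply: evaluates_div; last 2 first.
  + apply: evaluatesM; first exact/evaluatesN/evaluates_fq.
    exact: evaluatesM (evaluates_one_sub_fxq _) (evaluates_one_sub_fqVx _).
  + exact: evaluatesM (evaluates_one_sub_fxq _) (evaluates_one_sub_fqVx _).
  + rewrite mulf_neq0 ?(one_sub_xz_neq0 prz xd) //.
    exact: (one_sub_zVx_neq0 prz x0 xd).
have md : (m < d)%N by rewrite /d ltnS leq_pmull.
(* The vanishing numerator factor sits at i = m, the vanishing denominator factor at the last index
   i = d - 1 = sm. *)
rewrite prodf_div (bigD1 (Ordinal md)) //= [X in _ / X]big_ord_recr /=.
have -> a b c e : (a * b) / (c * e) = (a / e) * (b / c) :> {fraction Qqx}.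
  by rewrite [c * e]mulrC mulf_div.
apply: regularM.
(* The two exponents are d(sl+1) and ds(l+1), and a q^d-integer specializes to the ordinary
   integer. *)
- exists ((s * l).+1%:R / (s * l.+1)%:R).
  have -> : N (l * d + m)%N / D (l * d + s * m)%N
      = qint (fq ^+ d) (s * l).+1 / qint (fq ^+ d) (s * l.+1).
    have d1 : 1 - fq ^+ d != 0 by apply: one_sub_fq_neq0.
    rewrite -[RHS]mul1r -(divff d1) mulf_div !qint_mul_one_sub -!exprM.
    by congr ((1 - _ ^+ _) / (1 - _ ^+ _)); rewrite /d; lia.
  have qE e : evaluates phi (qint (fq ^+ d) e) e%:R.
    have -> : e%:R = qint (z ^+ d) e.
      rewrite /qint (prim_expr_order prz); under eq_bigr do rewrite expr1n.
      by rewrite sumr_const card_ord.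
    exact/evaluates_qint/evaluates_fq.
  apply: evaluates_div (qE _) (qE _).
  by rewrite -(prednK (_ : 0 < s * l.+1)%N) ?char0 // muln_gt0 s0.
- apply: regularM.
    by apply: regular_prod => i _; eexists; apply: evaluates_one_sub_fq.
  rewrite -prodfV; apply: regular_prod => i _.
  eexists; apply: evaluatesV; last exact: evaluates_one_sub_fq.
  apply: (one_sub_z_neq0 prz).
  have -> : (s * (l * d + i).+1 = s * l * d + s * i.+1)%N by lia.
  rewrite (dvdn_addr _ (dvdn_mull _ (dvdnn d))); apply: ndvd_d_mul => //.
  by rewrite ltnS ltn_ord.
Qed.

Lemma regular_periods l :
  regular (\prod_(j < l * d) alpha_step fx fq s j).
Proof.
elim: l => [|l IH].
  by rewrite mul0n big_ord0; exists 1; apply: evaluates1.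
rewrite mulSnr big_split_ord; apply: regularM => //.
exact: regular_period.
Qed.

Hypothesis d1 : (1 < d)%N.

(** The product of steps splits into k / d full periods, whose value is c, and a partial period that
    specializes factor by factor; [2sk+1] depends only on k modulo d. *)
Lemma evaluates_alpha_root r : exists c : nat -> L,
  forall k, (k < r * d)%N ->
  evaluates phi (alpha fx fq s k) (c (k %/ d)%N * alpha x z s (k %% d)).
Proof.
have [c cE] : exists c : 'I_r -> L, forall l : 'I_r,
    evaluates phi (\prod_(j < l * d) alpha_step fx fq s j) (c l).
  exact (fin_all_exists (fun l : 'I_r => regular_periods l)).
(* The default 0 is never reached, as k < rd forces k / d < r. *)
exists (fun l => if (insub l : option 'I_r) is Some i then c i else 0) => k kr.
have lr : (k %/ d < r)%N by rewrite ltn_divLR.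
have z0 : z != 0 by have := prim_root_eq0 prz; rewrite /d => ->.
rewrite (insubT (fun l => l < r)%N lr) /=.
have prodE e : e = (k %/ d * d + k %% d)%N ->
    \prod_(j < e) alpha_step fx fq s j
    = (\prod_(j < k %/ d * d) alpha_step fx fq s j)
      * \prod_(i < k %% d) alpha_step fx fq s (k %/ d * d + i).
  by move=> ->; rewrite big_split_ord.
rewrite !alphaE ?fq_neq0 // (prodE k (divn_eq k d)).
rewrite mulrCA; apply: evaluatesM (cE (Ordinal lr)) _.
apply: evaluatesM.
  have -> : qint z (2 * s * (k %% d)).+1 = qint z (2 * s * k).+1.
    have z1 : 1 - z != 0.
      by rewrite -[z]expr1 (one_sub_z_neq0 prz) // gtnNdvd.
    apply: (mulfI z1); rewrite !qint_mul_one_sub; congr (1 - _).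
    apply/eqP; rewrite (eq_prim_root_expr prz); apply/eqP.
    have -> : (2 * s * k).+1 = (2 * s * (k %/ d) * d + (2 * s * (k %% d)).+1)%N.
      by rewrite {1}(divn_eq k d); lia.
    by rewrite modnMDl.
  exact/evaluates_qint/evaluates_tofrac.
apply: evaluates_prod => i _.
rewrite -(alpha_step_periodic x s0 prz (k %/ d)%N).
apply: evaluates_alpha_step.
- exact: (one_sub_xz_neq0 prz xd).
- exact: (one_sub_zVx_neq0 prz x0 xd).
- apply: (one_sub_z_neq0 prz).
  have -> : (s * (k %/ d * d + i).+1 = s * (k %/ d) * d + s * i.+1)%N by lia.
  rewrite (dvdn_addr _ (dvdn_mull _ (dvdnn d))); apply: ndvd_d_mul => //.
  by apply: leq_ltn_trans (ltn_ord i) _; rewrite ltn_pmod.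
Qed.

Lemma evaluates_tsum_root N r : (0 < N <= s)%N ->
  evaluates phi (\sum_(0 <= k < r * d) tsum fx fq s N k) 0.
Proof.
case/andP=> N0 Ns; have [c cE] := evaluates_alpha_root r.
have := evaluates_sum_tsum N cE; rewrite poly_periodic //.
pose a := \poly_(i < m.+1) alpha x z s i.
have -> : \poly_(i < d) alpha x z s i = a.
  apply/polyP => i; rewrite !coef_poly.
  have md : (m < d)%N by rewrite /d ltnS leq_pmull.
  case: (ltnP i d) => id; case: (ltnP i m.+1) => im //.
    by rewrite (alpha_gt_half x s0 prz).
  by have := leq_trans im (leq_trans md id); rewrite ltnn.
(* Here N <= s enters: deg a^N <= Nm <= sm = d - 1. *)
have sa : (size (a ^+ N) <= d)%N.
  apply: leq_trans (size_exp_poly_leq _ (size_poly _ _)) _.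
  by rewrite /d ltnS leq_mul2r Ns orbT.
rewrite exprMn -rmorphXn /=.
rewrite sum_coef_comp_Xn_mul // horner_exp horner_poly.
have <- : \sum_(0 <= k < m.+1) alpha x z s k
    = \sum_(i < m.+1) alpha x z s i * 1 ^+ i.
  by rewrite big_mkord; apply: eq_bigr => i _; rewrite expr1n mulr1.
rewrite (sum_alpha_half s0 prz x0 xd d1 (char0 1)).
by rewrite expr0n -[N]prednK // mulr0.
Qed.

End Root.
End EvaluateAlpha.

Lemma all_divisors_1_mod (s d : nat) : (1 < s)%N -> (0 < d)%N ->
  (forall p, prime p -> (p %| d)%N -> p = 1 %[mod s]) -> d = 1 %[mod s].
Proof.
move=> s1; have [m] := ubnP d; elim: m d => // m IH d dm d0 pd.
have [d1|d1] := leqP d 1; first by have -> : d = 1%N by lia.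
have pp := pdiv_prime d1; have pdd := pdiv_dvd d.
have e1 : d %/ pdiv d = 1 %[mod s].
  apply: IH => [||p prp pdv]; last first.
  - by apply: pd => //; apply: dvdn_trans pdv (dvdn_div pdd).
  - by rewrite divn_gt0 ?pdiv_gt0 // dvdn_leq.
  - by apply: leq_trans (ltn_Pdiv (prime_gt1 pp) d0) _; rewrite -ltnS.
by rewrite -[in LHS](divnK pdd) -modnMml e1 modnMml mul1n pd.
Qed.

(** * The congruence *)

Lemma evaluates_tsum_expn (L : fieldType) (phi : {rmorphism Qqx -> L})
    (s N m : nat) (n := (s * m).+1) (t := phi pq) :
  (1 < s)%N -> (0 < N <= s)%N -> t != 0 ->
  (forall j, (0 < j)%N -> 1 - t ^+ j != 0) ->
  phi px = t ^+ n \/ phi px = (t ^+ n)^-1 ->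
  evaluates phi (\sum_(0 <= k < n) tsum fx fq s N k)
    ((t ^+ (s * 'C(m, 2) + m) * qint t n * (-1) ^+ m) ^+ N).
Proof.
move=> s1 /andP[N0 Ns] t0 t1 xE; have s0 := ltnW s1.
have tn0 k : t ^+ k != 0 by rewrite expf_neq0.
have x0 : phi px != 0 by case: xE => ->; rewrite ?invr_eq0.
have alphaE' k : alpha (t ^+ n) t s k = alpha (phi px) t s k.
  by case: xE => ->; rewrite ?alphaV.
have aE k : (k < n)%N -> evaluates phi (alpha fx fq s k) (alpha (t ^+ n) t s k).
  move=> kn; rewrite alphaE' !alphaE ?fq_neq0 //; apply: evaluatesM.
    exact/evaluates_qint/evaluates_tofrac.
  apply: evaluates_prod => j _.
  have h1 : 1 - t ^+ n * t ^+ (s * j.+1) != 0 by rewrite -exprD t1.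
  (* The exponent s(j+1) - n is nonzero because n is 1 modulo s. *)
  have h2 : 1 - t ^+ (s * j.+1) / t ^+ n != 0.
    rewrite subr_eq0 eq_sym -(inj_eq (mulIf (tn0 n))) mulfVK // mul1r.
    by rewrite (inj_eq (exp_generic_inj t0 t1)) mul_neq_succ_mul.
  apply: evaluates_alpha_step => //; last by rewrite t1 // muln_gt0 s0.
  - by case: xE => ->; rewrite // mulrC.
  - by case: xE => ->; rewrite // invrK mulrC.
have := evaluates_sum_tsum N aE.
pose a := \poly_(i < m.+1) alpha (t ^+ n) t s i.
have -> : \poly_(i < n) alpha (t ^+ n) t s i = a.
  have mn : (m < n)%N by rewrite /n ltnS leq_pmull.
  apply/polyP => i; rewrite !coef_poly.
  case: (ltnP i n) => iN; case: (ltnP i m.+1) => im //.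
    rewrite alphaE // (bigD1 (Ordinal im)) //= /alpha_step -/n divff //.
    by rewrite subrr !(mulr0, mul0r).
  by have := leq_trans im (leq_trans mn iN); rewrite ltnn.
(* As deg a^N <= Nm < n, the truncated sum contains every coefficient. *)
have -> : \sum_(0 <= k < n) (a ^+ N)`_k = (a ^+ N).[1].
  rewrite big_mkord (@horner_coef_wide _ n); last first.
    apply: leq_trans (size_exp_poly_leq _ (size_poly _ _)) _.
    by rewrite /n ltnS leq_mul2r Ns orbT.
  by apply: eq_bigr => i _; rewrite expr1n mulr1.
rewrite horner_exp horner_poly -(alpha_sum_expn m s1 t0 t1).
have <- // : \sum_(i < m.+1) alpha (t ^+ n) t s i * 1 ^+ i
    = \sum_(0 <= k < m.+1) alpha (t ^+ n) t s k.
by rewrite big_mkord; apply: eq_bigr => i _; rewrite expr1n mulr1.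
Qed.

(** With n - 1 = sm the factor s cancels and m(sm - s + 2)/2 = s binom(m,2) + m, so the integer
    division is exact. *)
Lemma exponentE (s N m : nat) : (0 < s)%N ->
  ((N%:Z * ((s * m).+1%:Z - 1) * ((s * m).+1%:Z - s%:Z + 1)) %/ (2 * s%:Z))%Z
  = (N * (s * 'C(m, 2) + m))%N%:Z.
Proof.
move=> s0.
have C2 : (m * m = 2 * 'C(m, 2) + m)%N.
  by elim: m => // m IH; rewrite binS bin1; lia.
have -> : (N%:Z * ((s * m).+1%:Z - 1) * ((s * m).+1%:Z - s%:Z + 1))
   = (N * (s * 'C(m, 2) + m))%N%:Z * (2 * s%:Z).
  nia.
by rewrite mulzK //; lia.
Qed.

Section Congruence.
Variables (s N n : nat).
Hypotheses (s1 : (1 < s)%N) (NS : (0 < N <= s)%N) (hn : (0 < n)%N).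
Hypothesis hprimes : forall p : nat, prime p -> (p %| n)%N -> p = 1 %[mod s].

Let rhs : {fraction Qqx} :=
  fq ^ ((N%:Z * (n%:Z - 1) * (n%:Z - s%:Z + 1)) %/ (2 * s%:Z))%Z
  * qint fq n ^+ N * (-1) ^+ ((N * (n - 1)) %/ s)%N.

(** Serves both for n itself and for the order d of a root of unity, which can be any divisor of n
    above 1. *)
Lemma divisorE d : (0 < d)%N -> (d %| n)%N -> exists m, d = (s * m).+1.
Proof.
move=> d0 dn; exists (d %/ s)%N; rewrite {1}(divn_eq d s) mulnC -addn1.
rewrite (all_divisors_1_mod s1 d0) ?modn_small // => p pp pd.
by rewrite hprimes ?modn_small //; apply: dvdn_trans dn.
Qed.

Lemma rhsE m : n = (s * m).+1 ->
  rhs = (fq ^+ (s * 'C(m, 2) + m) * qint fq n * (-1) ^+ m) ^+ N.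
Proof.
have s0 := ltnW s1; rewrite /rhs => nE.
rewrite nE exponentE // subn1 /= mulnCA mulKn // -nE -exprnP.
by rewrite !exprMn -!exprM [(_ * N)%N]mulnC [(m * N)%N]mulnC.
Qed.

Variables (L : fieldType) (phi : {rmorphism Qqx -> L}).

Lemma evaluates_rhs m : n = (s * m).+1 ->
  evaluates phi rhs
    ((phi pq ^+ (s * 'C(m, 2) + m) * qint (phi pq) n * (-1) ^+ m) ^+ N).
Proof.
move/rhsE => ->; apply: evaluatesX; apply: evaluatesM; last first.
  exact/evaluatesX/evaluatesN/evaluates1.
apply: evaluatesM; first exact: evaluates_fq.
exact/evaluates_qint/evaluates_tofrac.
Qed.

(** The image of q is a primitive root of some order d dividing n, so the n summands form n/d
    complete periods with sum 0; on the right [n]^N vanishes. *)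
Lemma evaluates_diff_root :
  phi pq ^+ n = 1 -> phi pq != 1 -> phi px != 0 ->
  (forall d, (0 < d)%N -> 1 - phi px ^+ d != 0) ->
  (forall k, k.+1%:R != 0 :> L) ->
  evaluates phi (\sum_(0 <= k < n) tsum fx fq s N k - rhs) 0.
Proof.
move=> zn z1 x0 x1 char0; have [m nE] := divisorE hn (dvdnn n).
have [d prz dn] := prim_order_exists hn zn.
have d0 := prim_order_gt0 prz.
have [k dE] := divisorE d0 dn.
have d1 : (1 < d)%N.
  rewrite ltn_neqAle d0 andbT eq_sym; apply: contra z1 => /eqP d1.
  by rewrite -[phi pq]expr1 -d1 (prim_expr_order prz).
have xd : phi px ^+ d != 1 by rewrite eq_sym -subr_eq0 x1.
have D : evaluates phi (\sum_(0 <= k < n) tsum fx fq s N k) 0.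
  rewrite -{1}(divnK dn); rewrite dE in d1 prz xd *.
  exact: (evaluates_tsum_root (ltnW s1) x0 prz xd char0 d1 _ NS).
have R : evaluates phi rhs 0.
  have := evaluates_rhs nE; rewrite qint_root_eq0 // mulr0 mul0r expr0n.
  by rewrite eqn0Ngt; case/andP: NS => ->.
by have := evaluatesB D R; rewrite subr0.
Qed.

Lemma evaluates_diff_expn : phi pq != 0 ->
  (forall j, (0 < j)%N -> 1 - phi pq ^+ j != 0) ->
  phi px = phi pq ^+ n \/ phi px = (phi pq ^+ n)^-1 ->
  evaluates phi (\sum_(0 <= k < n) tsum fx fq s N k - rhs) 0.
Proof.
move=> t0 t1 xE; have [m nE] := divisorE hn (dvdnn n).
have D : evaluates phi (\sum_(0 <= k < n) tsum fx fq s N k)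
    ((phi pq ^+ (s * 'C(m, 2) + m) * qint (phi pq) n * (-1) ^+ m) ^+ N).
  by rewrite nE in xE *; apply: evaluates_tsum_expn.
by have := evaluatesB D (evaluates_rhs nE); rewrite subrr.
Qed.

End Congruence.

Theorem theorem1 (s N : nat) (h2N : (2 <= N)%N) (hNs : (N <= s)%N)
    (n : nat) (hn : (0 < n)%N)
    (hprimes : forall p : nat, prime p -> (p %| n)%N -> p = 1 %[mod s]) :
  congr_frac
    (\sum_(0 <= k < n) tsum fx fq s N k)
    (fq ^ ((N%:Z * (n%:Z - 1) * (n%:Z - s%:Z + 1)) %/ (2 * s%:Z))%Z
     * qint fq n ^+ N * (-1) ^+ ((N * (n - 1)) %/ s)%N)
    (qint pq n * (1 - px * pq ^+ n) * (px - pq ^+ n)).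
Proof.
have s1 : (1 < s)%N by apply: leq_trans hNs.
have NS : (0 < N <= s)%N by rewrite (ltnW h2N) hNs.
apply: (@congr_frac_eval _ _ (roots_fam n)).
- exact: modulus_neq0.
- by move=> a; apply: modulus_dvd.
- exact: roots_fam_modulus.
- exact: roots_fam_ker.
- exact: lowest_terms.
move=> phi [[z [zn z1 phiE]]|phiE|phiE].
- have xE : phi px = genL by rewrite phiE; exact: spec_q_px.
  apply: evaluates_diff_root => //.
  + by rewrite phiE; apply: spec_q_pq_expn.
  + by rewrite phiE; apply: spec_q_pq_neq1.
  + by rewrite xE; apply: genL_neq0.
  + by rewrite xE; apply: genL_exp_neq1.
  + exact: Lx_natr_neq0.
- have qE : phi pq = genL by rewrite phiE; exact: spec_x_pq.
  apply: evaluates_diff_expn => //; rewrite qE.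
  + exact: genL_neq0.
  + exact: genL_exp_neq1.
  + by left; rewrite phiE; apply: spec_x_px.
- have qE : phi pq = genL by rewrite phiE; exact: spec_x_pq.
  apply: evaluates_diff_expn => //; rewrite qE.
  + exact: genL_neq0.
  + exact: genL_exp_neq1.
  + by right; rewrite phiE; apply: spec_x_px.
Qed.
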